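(* Let $I=\{(0,0),(1,0)\}\cup\{(i,m): i\ge 1,\ m\in\{1,2,3\}\}$. For all $(i,m),(j,n)\in I$, $$\mathbb{B}_{(i,m)}\in HS(\mathbb{B}_{(j,n)})\iff i\le j\ \text{ and }\ m\le n.$$
   Context: All algebras are in the signature $\langle L,\wedge,\vee,{}',{}^*,0,1\rangle$; $HS(A)$ denotes the class of homomorphic images of subalgebras of $A$ (up to isomorphism). For bounded distributive lattices, $L_1\oplus L_2$ is the ordinal sum ($L_2$ placed above $L_1$) with $1^{L_1}$ and $0^{L_2}$ identified. For $i\ge1$ and $m\in\{1,2,3\}$, $\mathbb{B}_{(i,m)}$ is the algebra whose lattice is $B_i\oplus C_m\oplus B_i$, where $B_i$ is the Boolean lattice with $i$ atoms and $C_m$ is the $m$-element chain. Its operation ${}'$ is the order-reversing involution sending an element $a$ of the lower copy of $B_i$ to the element of the upper copy corresponding to the Boolean complement of $a$ (and vice versa), and reversing the chain $C_m$; ${}^*$ is the pseudocomplement of the lattice ($a\wedge b=0\Leftrightarrow b\le a^*$). $\mathbb{B}_{(1,0)}$ denotes the two-element chain $\{0,1\}$ with $0'=0^*=1$, $1'=1^*=0$, and $\mathbb{B}_{(0,0)}$ denotes the trivial one-element algebra. These algebras are the finite subdirectly irreducible members (together with the trivial algebra) of the variety of bundle pseudocomplemented Kleene algebras. *)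

(* Defs.v *)
From HB Require Import structures.
From mathcomp Require Import all_boot all_order.
Set Implicit Arguments.
Unset Strict Implicit.
Unset Printing Implicit Defensive.

Import Order.TTheory.
Import Order.DefaultSetSubsetOrder.
Local Open Scope order_scope.

(* [ainv] is the operation ' and [apc] is the operation *. *)
Record algebra := Algebra {
  carrier :> Type;
  ameet : carrier -> carrier -> carrier;
  ajoin : carrier -> carrier -> carrier;
  ainv : carrier -> carrier;
  apc : carrier -> carrier;
  azero : carrier;
  aone : carrier }.

Arguments azero {a}.
Arguments aone {a}.

Record subuniverse (A : algebra) := Subuniverse {
  in_sub :> A -> Prop;
  sub_meet : forall x y, in_sub x -> in_sub y -> in_sub (ameet x y);
  sub_join : forall x y, in_sub x -> in_sub y -> in_sub (ajoin x y);
  sub_inv : forall x, in_sub x -> in_sub (ainv x);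
  sub_pc : forall x, in_sub x -> in_sub (apc x);
  sub_zero : in_sub azero;
  sub_one : in_sub aone }.

Definition subalgebra (A : algebra) (S : subuniverse A) : algebra := {|
  carrier := {x : A | S x};
  ameet x y := exist _ _ (sub_meet (svalP x) (svalP y));
  ajoin x y := exist _ _ (sub_join (svalP x) (svalP y));
  ainv x := exist _ _ (sub_inv (svalP x));
  apc x := exist _ _ (sub_pc (svalP x));
  azero := exist _ _ (sub_zero S);
  aone := exist _ _ (sub_one S) |}.

Record is_hom (A B : algebra) (h : A -> B) : Prop := IsHom {
  hom_meet : forall x y, h (ameet x y) = ameet (h x) (h y);
  hom_join : forall x y, h (ajoin x y) = ajoin (h x) (h y);
  hom_inv : forall x, h (ainv x) = ainv (h x);
  hom_pc : forall x, h (apc x) = apc (h x);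
  hom_zero : h azero = azero;
  hom_one : h aone = aone }.

(* [HS A B] means that B is in HS(A); closure under isomorphism is automatic,
   since h is any surjective homomorphism. *)
Definition HS (A B : algebra) : Prop :=
  exists (S : subuniverse A) (h : subalgebra S -> B),
    is_hom h /\ (forall y : B, exists x, h x = y).

(* The ordinal sum of L1 and L2 (L2 on top), realized inside the product
   lattice: a in L1 is the pair (a, \bot), b in L2 is the pair (\top, b), and
   the two pairs (\top, \bot) obtained from \top in L1 and \bot in L2 coincide.
   See le_osum_lo, le_osum_hi, le_osum_lo_hi, osum_glue and osumP. *)
Section OrdinalSum.
Context {d1 d2 : Order.disp_t}.
Variables (L1 : finTBDistrLatticeType d1) (L2 : finTBDistrLatticeType d2).

Definition in_osum : pred (L1 *p L2) := fun p => (p.1 == \top) || (p.2 == \bot).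

Record osum := Osum { osum_val : L1 *p L2; osum_valP : in_osum osum_val }.

HB.instance Definition _ := [isSub for osum_val].
HB.instance Definition _ := [Finite of osum by <:].

Fact in_osum_meet : {in in_osum &, forall p q, p `&` q \in in_osum}.
Proof.
move=> [a b] [c d]; rewrite !unfold_in /=.
case: (eqVneq b \bot) => [->|nb] /=; first by rewrite meet0x eqxx !orbT.
rewrite orbF => /eqP ->.
case: (eqVneq d \bot) => [->|nd] /=; first by rewrite meetx0 eqxx !orbT.
by rewrite orbF => /eqP ->; rewrite meetxx eqxx.
Qed.

Fact in_osum_join : {in in_osum &, forall p q, p `|` q \in in_osum}.
Proof.
move=> [a b] [c d]; rewrite !unfold_in /=.
case: (eqVneq a \top) => [->|na] /=; first by rewrite join1x eqxx.
move=> /eqP ->.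
case: (eqVneq c \top) => [->|nc] /=; first by rewrite joinx1 eqxx.
by move=> /eqP ->; rewrite joinxx eqxx orbT.
Qed.

Fact in_osum_bot : \bot \in in_osum.
Proof. by rewrite unfold_in /= eqxx orbT. Qed.

Fact in_osum_top : \top \in in_osum.
Proof. by rewrite unfold_in /= eqxx. Qed.

HB.instance Definition _ :=
  Order.SubChoice_isTBSubLattice.Build _ _ in_osum
    (Order.prod_display d1 d2) osum
    in_osum_meet in_osum_join in_osum_bot in_osum_top.

Fact osum_meetUl : @left_distributive osum osum Order.meet Order.join.
Proof. by move=> x y z; apply: val_inj; exact: meetUl. Qed.

HB.instance Definition _ :=
  Order.Lattice_Meet_isDistrLattice.Build (Order.prod_display d1 d2) osum
    osum_meetUl.

Fact in_osum_lo (a : L1) : in_osum (a, \bot).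
Proof. by rewrite /in_osum eqxx orbT. Qed.
Definition osum_lo (a : L1) : osum := Osum (in_osum_lo a).

Fact in_osum_hi (b : L2) : in_osum (\top, b).
Proof. by rewrite /in_osum eqxx. Qed.
Definition osum_hi (b : L2) : osum := Osum (in_osum_hi b).

Lemma osumP (x : osum) : (exists a, x = osum_lo a) \/ (exists b, x = osum_hi b).
Proof.
case: x => [[a b]] h; have /orP[/eqP e|/eqP e] := h; rewrite /= in e.
  by right; exists b; apply: val_inj; rewrite /= e.
by left; exists a; apply: val_inj; rewrite /= e.
Qed.

Lemma osum_glue : osum_lo \top = osum_hi \bot.
Proof. exact: val_inj. Qed.

Lemma le_osum_lo (a a' : L1) : (osum_lo a <= osum_lo a') = (a <= a').
Proof. by rewrite -Order.le_val leEprod /= lexx andbT. Qed.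

Lemma le_osum_hi (b b' : L2) : (osum_hi b <= osum_hi b') = (b <= b').
Proof. by rewrite -Order.le_val leEprod /= lexx. Qed.

Lemma le_osum_lo_hi (a : L1) (b : L2) : osum_lo a <= osum_hi b.
Proof. by rewrite -Order.le_val leEprod /= lex1 le0x. Qed.

End OrdinalSum.

(* The join of all x disjoint from a; see pcompP. *)
Definition pcomp {d : Order.disp_t} {L : finTBDistrLatticeType d} (a : L) : L :=
  \join_(x | a `&` x == \bot) x.

Lemma pcompP {d : Order.disp_t} (L : finTBDistrLatticeType d) (a b : L) :
  (a `&` b == \bot) = (b <= pcomp a).
Proof.
apply/idP/idP => [h|h]; first exact: joins_sup.
have h0 : a `&` pcomp a = \bot.
  apply/eqP; rewrite /pcomp -lex0.
  elim/big_ind: _ => [|x y hx hy|x /eqP ->] //; first by rewrite meetx0.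
  by rewrite meetUr leUx hx hy.
by rewrite -lex0 -h0 leI2.
Qed.

(* An alias of 'I_k.+1, which has no tbDistrLatticeType instance of its own. *)
Definition chain (k : nat) := 'I_k.+1.
HB.instance Definition _ k := Order.FinTotal.on (chain k).
HB.instance Definition _ k := @Order.hasBottom.Build _ (chain k) ord0 leq0n.
HB.instance Definition _ k := @Order.hasTop.Build _ (chain k) ord_max (@leq_ord _).

(* The lattice B_i (+) C_m (+) B_i for m = k + 1, with B_i the powerset of 'I_i. *)
Section Bundle.
Variables i k : nat.

Definition bundle_lattice := osum (osum {set 'I_i} (chain k)) {set 'I_i}.

HB.instance Definition _ := Order.FinTBDistrLattice.on bundle_lattice.

Definition blo (a : {set 'I_i}) : bundle_lattice := osum_lo _ (osum_lo _ a).
Definition bmid (c : chain k) : bundle_lattice := osum_lo _ (osum_hi _ c).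
Definition bhi (b : {set 'I_i}) : bundle_lattice := osum_hi _ b.

Lemma bundleP (x : bundle_lattice) :
  [\/ exists a, x = blo a, exists c, x = bmid c | exists b, x = bhi b].
Proof.
case: (osumP x) => [[y ->]|[b ->]]; last by constructor 3; exists b.
case: (osumP y) => [[a ->]|[c ->]]; first by constructor 1; exists a.
by constructor 2; exists c.
Qed.

(* The involution reverses the triple (a, c, b) of coordinates in B_i * C_m * B_i
   while dualizing each factor; see binv_lo, binv_mid and binv_hi. *)
Fact binv_inner (x : bundle_lattice) :
  in_osum (~: (val x).2, rev_ord (val (val x).1).2 : chain k).
Proof.
case: (bundleP x) => -[y ->]; rewrite /in_osum /= ?setC0 ?eqxx //.
by apply/orP; right; apply/eqP/val_inj; rewrite /= subnn.
Qed.

Fact binv_outer (x : bundle_lattice) :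
  in_osum (Osum (binv_inner x), ~: (val (val x).1).1).
Proof.
case: (bundleP x) => -[y ->]; rewrite /in_osum /= ?setCT ?eqxx ?orbT //.
apply/orP; left; apply/eqP/val_inj => /=; rewrite setC0.
by congr pair; apply: val_inj; rewrite /= subn1.
Qed.

Definition binv (x : bundle_lattice) : bundle_lattice := Osum (binv_outer x).

Lemma binv_lo (a : {set 'I_i}) : binv (blo a) = bhi (~: a).
Proof.
apply: val_inj; congr pair; apply: val_inj => /=; rewrite setC0.
by congr pair; apply: val_inj; rewrite /= subn1.
Qed.

Lemma binv_mid (c : chain k) : binv (bmid c) = bmid (rev_ord c).
Proof.
apply: val_inj => /=; rewrite setCT; congr pair.
by apply: val_inj; rewrite /= setC0.
Qed.

Lemma binv_hi (b : {set 'I_i}) : binv (bhi b) = blo (~: b).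
Proof.
apply: val_inj => /=; rewrite setCT; congr pair; apply: val_inj => /=.
by congr pair; apply: val_inj; rewrite /= subnn.
Qed.

Lemma binvK : involutive binv.
Proof.
move=> x; case: (bundleP x) => -[y ->].
- by rewrite binv_lo binv_hi setCK.
- by rewrite !binv_mid rev_ordK.
- by rewrite binv_hi binv_lo setCK.
Qed.

Lemma le_binv (x y : bundle_lattice) : (binv x <= binv y) = (y <= x).
Proof.
case: x y => [[[[a c] h] b] g] [[[[a' c'] h'] b'] g'].
rewrite -!Order.le_val /= !leEprod -!Order.le_val /= !leEprod /=.
have leC (u v : {set 'I_i}) : (~: u <= ~: v) = (v <= u) by exact: setCS.
have leR (u v : chain k) : ((rev_ord u : chain k) <= rev_ord v) = (v <= u).
  by rewrite !leEord /= leq_sub2lE // ltn_ord.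
by rewrite !leC leR; case: (a' <= a); case: (c' <= c); case: (b' <= b).
Qed.

Definition bundle : algebra := {|
  carrier := bundle_lattice;
  ameet x y := x `&` y;
  ajoin x y := x `|` y;
  ainv := binv;
  apc := pcomp;
  azero := \bot;
  aone := \top |}.

End Bundle.

Definition two_chain : algebra := {|
  carrier := bool;
  ameet := andb;
  ajoin := orb;
  ainv := negb;
  apc := negb;
  azero := false;
  aone := true |}.

Definition trivial_algebra : algebra := {|
  carrier := unit;
  ameet _ _ := tt;
  ajoin _ _ := tt;
  ainv _ := tt;
  apc _ := tt;
  azero := tt;
  aone := tt |}.

Definition in_I (i m : nat) : bool :=
  ((i, m) \in [:: (0, 0); (1, 0)]) || (1 <= i)%N && (m \in [:: 1; 2; 3])%N.

(* Values at pairs outside of [in_I] are irrelevant. *)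
Definition BB (i m : nat) : algebra :=
  match m, i with
  | 0, 0 => trivial_algebra
  | 0, _ => two_chain
  | k.+1, _ => bundle i k
  end.

(* Main.v *)
From mathcomp Require Import all_boot all_order zify.
From Stdlib Require Import IndefiniteDescription ProofIrrelevance.
Require Import Defs.
Set Implicit Arguments.
Unset Strict Implicit.
Unset Printing Implicit Defensive.

Import Order.TTheory.
Import Order.DefaultSetSubsetOrder.
Local Open Scope order_scope.

(** Membership in HS(A) is witnessed by a partial surjective homomorphism,
    that is, by a functional and onto relation compatible with the operations
    ([HSP]); this removes subalgebras and quotients from the discussion.

    Write an element of a bundle algebra as its triple (lo, mid, hi) in
    B_i * C_m * B_i.  Lattice operations and the involution are computed on
    coordinates.  The pseudocomplement of x is 1 if lo x is empty and is
    otherwise the complement of lo x in the lower copy of B_i ([pcompE]); so it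
    depends on lo x only, and lo turns it into Boolean complementation.

    Sufficiency ([HS_bundle_quotient]).  For 1 <= i <= j, pull subsets of 'I_i
    back along a surjection p : 'I_j -> 'I_i: this embeds B_i in B_j as a
    Boolean subalgebra.  The embedding keeps nonempty sets nonempty, as the case
    distinction in the pseudocomplement demands.  On the chains 0 < ... < k and
    0 < ... < l, take for l <= k the relation that c in the first has the same
    relative height as d in the second, c * l = d * k.  It is compatible with
    reversal and with the lattice operations, collapses the first chain when
    l = 0, is the identity when l = k, and picks the endpoints of the first
    chain when l = 1: every case with l <= k <= 2.

    Necessity.  Elements with the same lo have the same pseudocomplement, hence
    so do their images, and then the images have the same lo.  This sends lo
    coordinates of sources onto all 2^i values below, so 2^i <= 2^j
    ([HS_bundle_rank]).  The elements of the middle chain are the x such that x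
    and x' are both dense.  If x is mapped to an element y of the middle chain,
    then w = x \/ x* is dense, v = w /\ u' with u = w'* lies in the middle
    chain, and both are still mapped to y; so the middle chain of the source
    covers that of the target ([HS_bundle_center]).

    The two small algebras are separated from the others by the identities
    0 = 1 and x' = x*, which HS preserves. *)

(** * HS through partial surjective homomorphisms *)

Record partial_epi (A B : algebra) (R : A -> B -> Prop) : Prop := PartialEpi {
  pe_meet : forall x y x' y',
    R x y -> R x' y' -> R (ameet x x') (ameet y y');
  pe_join : forall x y x' y',
    R x y -> R x' y' -> R (ajoin x x') (ajoin y y');
  pe_inv : forall x y, R x y -> R (ainv x) (ainv y);
  pe_pc : forall x y, R x y -> R (apc x) (apc y);
  pe_zero : R azero azero;
  pe_one : R aone aone;
  pe_fun : forall x y y', R x y -> R x y' -> y = y';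
  pe_onto : forall y, exists x, R x y }.

(** From left to right, the relation is the graph of the quotient map; it is
    functional on A because membership proofs are irrelevant.  Conversely, the
    domain of the relation is the subalgebra, and description turns the
    relation into a map on it. *)
Lemma HSP (A B : algebra) :
  HS A B <-> exists R : A -> B -> Prop, partial_epi R.
Proof.
split=> [[S [h [hh surj]]]|[R hR]].
  exists (fun x y => exists s : subalgebra S, sval s = x /\ h s = y).
  split=> [_ _ _ _ [s [<- <-]] [t [<- <-]]|_ _ _ _ [s [<- <-]] [t [<- <-]]
          |_ _ [s [<- <-]]|_ _ [s [<- <-]]||
          |x y y' [[s ps] [<- <-]] [[t pt] [/= ets <-]]|y].
  - by exists (ameet s t); rewrite (hom_meet hh).
  - by exists (ajoin s t); rewrite (hom_join hh).
  - by exists (ainv s); rewrite (hom_inv hh).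
  - by exists (apc s); rewrite (hom_pc hh).
  - by exists azero; rewrite (hom_zero hh).
  - by exists aone; rewrite (hom_one hh).
  - by subst t; rewrite (proof_irrelevance _ ps pt).
  - by have [s <-] := surj y; exists (sval s), s.
pose P x := exists y, R x y.
have Pm x y : P x -> P y -> P (ameet x y).
  by move=> [u Ru] [v Rv]; exists (ameet u v); apply: (pe_meet hR).
have Pj x y : P x -> P y -> P (ajoin x y).
  by move=> [u Ru] [v Rv]; exists (ajoin u v); apply: (pe_join hR).
have Pi x : P x -> P (ainv x).
  by move=> [u Ru]; exists (ainv u); apply: (pe_inv hR).
have Pc x : P x -> P (apc x).
  by move=> [u Ru]; exists (apc u); apply: (pe_pc hR).
have P0 : P azero by exists azero; apply: (pe_zero hR).
have P1 : P aone by exists aone; apply: (pe_one hR).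
pose S := Subuniverse Pm Pj Pi Pc P0 P1.
pose h (s : subalgebra S) : B :=
  proj1_sig (constructive_indefinite_description _ (svalP s)).
have Rh s : R (sval s) (h s).
  exact: proj2_sig (constructive_indefinite_description _ (svalP s)).
exists S, h; split.
  split=> [s t|s t|s|s||]; apply: (pe_fun hR); try exact: Rh.
  - by apply: (pe_meet hR); exact: Rh.
  - by apply: (pe_join hR); exact: Rh.
  - by apply: (pe_inv hR); exact: Rh.
  - by apply: (pe_pc hR); exact: Rh.
  - exact: pe_zero hR.
  - exact: pe_one hR.
move=> y; have [x Rx] := pe_onto hR y.
have Sx : S x by exists y.
by exists (exist _ x Sx); apply: (pe_fun hR (Rh (exist _ x Sx))).
Qed.

Lemma HS_refl A : HS A A.
Proof.
apply/HSP; exists eq; split=> //; try by move=> *; subst.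
by move=> y; exists y.
Qed.

Lemma HS_trivial A : HS A trivial_algebra.
Proof.
apply/HSP; exists (fun _ _ => True); split=> //; first by move=> _ [] [].
by move=> y; exists azero.
Qed.

Lemma HS_zero_one A B :
  HS A B -> azero = aone :> A -> azero = aone :> B.
Proof.
move=> /HSP[R hR] e; apply: (pe_fun hR (pe_zero hR)).
by rewrite e; apply: pe_one hR.
Qed.

Lemma HS_inv_pc A B :
  HS A B -> (forall x : A, ainv x = apc x) -> forall y : B, ainv y = apc y.
Proof.
move=> /HSP[R hR] e y; have [x Rx] := pe_onto hR y.
by apply: (pe_fun hR (pe_inv hR Rx)); rewrite e; apply: pe_pc.
Qed.

(** An element has many preimages under a partial epimorphism, none of them
    distinguished, so cardinals are compared through a relation. *)
Lemma leq_card_rel (X Y : finType) (T : X -> Y -> Prop) :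
    (forall x, exists y, T x y) ->
    (forall x x' y, T x y -> T x' y -> x = x') ->
  (#|X| <= #|Y|)%N.
Proof.
move=> /fin_all_exists[f fT] inj; apply: (leq_card f) => x x' e.
by apply: (inj _ _ (f x)); rewrite // e.
Qed.

(** * Coordinates of bundle elements *)

(** Over abstract summands these equations are a short conversion, which is no
    longer the case for the nested sum [bundle_lattice]; there, rewriting with
    them replaces the conversion. *)
Section OsumOps.
Context {d1 d2 : Order.disp_t}.
Variables (L1 : finTBDistrLatticeType d1) (L2 : finTBDistrLatticeType d2).
Implicit Types x y : osum L1 L2.

Lemma osum_meetE x y :
  val (x `&` y) = ((val x).1 `&` (val y).1, (val x).2 `&` (val y).2).
Proof. by []. Qed.

Lemma osum_joinE x y :
  val (x `|` y) = ((val x).1 `|` (val y).1, (val x).2 `|` (val y).2).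
Proof. by []. Qed.

Lemma osum_botE : val (\bot : osum L1 L2) = (\bot, \bot).
Proof. by []. Qed.

Lemma osum_topE : val (\top : osum L1 L2) = (\top, \top).
Proof. by []. Qed.

End OsumOps.

Section Coordinates.
Variables i k : nat.
Implicit Types x y z : bundle_lattice i k.

Definition lo x : {set 'I_i} := (val (val x).1).1.
Definition mid x : chain k := (val (val x).1).2.
Definition hi x : {set 'I_i} := (val x).2.

Lemma bundle_ext x y : lo x = lo y -> mid x = mid y -> hi x = hi y -> x = y.
Proof.
case: x y => [[[[a c] h] b] g] [[[[a' c'] h'] b'] g'].
rewrite /lo /mid /hi /= => ea ec eb; subst a' c' b'.
by do 2! (apply: val_inj => /=; congr pair).
Qed.

Lemma le_bundle x y :
  (x <= y) = [&& lo x \subset lo y, mid x <= mid y & hi x \subset hi y].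
Proof. by rewrite -!Order.le_val !leEprod -!Order.le_val !leEprod andbA. Qed.

Lemma lo_meet x y : lo (x `&` y) = lo x :&: lo y.
Proof. by rewrite /lo (osum_meetE x y). Qed.
Lemma mid_meet x y : mid (x `&` y) = mid x `&` mid y.
Proof. by rewrite /mid (osum_meetE x y). Qed.
Lemma hi_meet x y : hi (x `&` y) = hi x :&: hi y.
Proof. by rewrite /hi (osum_meetE x y). Qed.

Lemma lo_join x y : lo (x `|` y) = lo x :|: lo y.
Proof. by rewrite /lo (osum_joinE x y). Qed.
Lemma mid_join x y : mid (x `|` y) = mid x `|` mid y.
Proof. by rewrite /mid (osum_joinE x y). Qed.
Lemma hi_join x y : hi (x `|` y) = hi x :|: hi y.
Proof. by rewrite /hi (osum_joinE x y). Qed.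

Lemma lo_binv x : lo (binv x) = ~: hi x. Proof. by []. Qed.
Lemma mid_binv x : mid (binv x) = rev_ord (mid x). Proof. by []. Qed.
Lemma hi_binv x : hi (binv x) = ~: lo x. Proof. by []. Qed.

Lemma lo_bot : lo \bot = set0.
Proof. by rewrite /lo (@osum_botE _ _ (osum {set 'I_i} (chain k))). Qed.
Lemma mid_bot : mid \bot = ord0.
Proof. by rewrite /mid (@osum_botE _ _ (osum {set 'I_i} (chain k))). Qed.
Lemma hi_bot : hi \bot = set0.
Proof. by rewrite /hi (@osum_botE _ _ (osum {set 'I_i} (chain k))). Qed.

Lemma lo_top : lo \top = setT.
Proof. by rewrite /lo (@osum_topE _ _ (osum {set 'I_i} (chain k))). Qed.
Lemma mid_top : mid \top = ord_max.
Proof. by rewrite /mid (@osum_topE _ _ (osum {set 'I_i} (chain k))). Qed.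
Lemma hi_top : hi \top = setT.
Proof. by rewrite /hi (@osum_topE _ _ (osum {set 'I_i} (chain k))). Qed.

Lemma lo_blo (a : {set 'I_i}) : lo (blo k a) = a. Proof. by []. Qed.
Lemma mid_blo (a : {set 'I_i}) : mid (blo k a) = ord0. Proof. by []. Qed.
Lemma hi_blo (a : {set 'I_i}) : hi (blo k a) = set0. Proof. by []. Qed.
Lemma lo_bmid (c : chain k) : lo (bmid i c) = setT. Proof. by []. Qed.
Lemma mid_bmid (c : chain k) : mid (bmid i c) = c. Proof. by []. Qed.
Lemma hi_bmid (c : chain k) : hi (bmid i c) = set0. Proof. by []. Qed.
Lemma lo_bhi (b : {set 'I_i}) : lo (bhi k b) = setT. Proof. by []. Qed.
Lemma mid_bhi (b : {set 'I_i}) : mid (bhi k b) = ord_max. Proof. by []. Qed.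
Lemma hi_bhi (b : {set 'I_i}) : hi (bhi k b) = b. Proof. by []. Qed.

Lemma bmidE x : lo x = setT -> hi x = set0 -> x = bmid i (mid x).
Proof. by move=> lo_x hi_x; apply: bundle_ext. Qed.

End Coordinates.

Definition coordE :=
  (lo_meet, mid_meet, hi_meet, lo_join, mid_join, hi_join,
   lo_binv, mid_binv, hi_binv, (lo_bot, mid_bot, hi_bot),
   (lo_top, mid_top, hi_top), (lo_blo, mid_blo, hi_blo),
   (lo_bmid, mid_bmid, hi_bmid), (lo_bhi, mid_bhi, hi_bhi)).

Lemma binv_bot i k : binv (\bot : bundle_lattice i k) = \top.
Proof.
apply: bundle_ext; rewrite !coordE ?setC0 //.
by apply: val_inj; rewrite /= subn1.
Qed.

(** * The pseudocomplement *)

Section Pseudocomplement.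
Variables i k : nat.
Hypothesis i_gt0 : (0 < i)%N.
Implicit Types x y z : bundle_lattice i k.

Lemma setT_neq0 : [set: 'I_i] != set0.
Proof. by rewrite -card_gt0 cardsT card_ord. Qed.

(** For i = 0 the two copies of B_i degenerate to points and lo carries no
    information: hence the standing assumption 0 < i. *)
Lemma bundle_bot x : lo x = set0 -> x = \bot.
Proof.
case: (bundleP x) => -[a ->]; rewrite coordE => e.
- by apply: bundle_ext; rewrite !coordE.
- by have := setT_neq0; rewrite e eqxx.
- by have := setT_neq0; rewrite e eqxx.
Qed.

(** Disjointness from x is disjointness of the lo coordinates.  If lo x is
    nonempty, a z disjoint from x has a proper subset as lo z, hence lies in the
    lower copy. *)
Lemma pcompE x : pcomp x = if lo x == set0 then \top else blo k (~: lo x).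
Proof.
have disj z : (x `&` z == \bot) = (lo x :&: lo z == set0).
  apply/eqP/eqP => [e|e]; last by apply: bundle_bot; rewrite lo_meet.
  by rewrite -lo_meet e lo_bot.
suff le_pcomp z : (z <= pcomp x) =
    (z <= if lo x == set0 then \top else blo k (~: lo x)).
  by apply: le_anti; rewrite -le_pcomp lexx le_pcomp lexx.
rewrite -pcompP disj; case: (eqVneq (lo x) set0) => [->|lo_x].
  by rewrite set0I eqxx lex1.
rewrite le_bundle !coordE setIC setI_eq0 disjoints_subset.
case lo_z: (lo z \subset _) => //=; apply/esym.
case: (bundleP z) lo_z => -[a ->]; rewrite !coordE ?lexx ?subxx //.
- by rewrite subTset -setC0 => /eqP/setC_inj e; rewrite e eqxx in lo_x.
- by rewrite subTset -setC0 => /eqP/setC_inj e; rewrite e eqxx in lo_x.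
Qed.

Lemma lo_pcomp x : lo (pcomp x) = ~: lo x.
Proof. by rewrite pcompE; case: eqP => [->|_]; rewrite !coordE ?setC0. Qed.

Lemma pcomp_lo_setT x : lo x = setT -> pcomp x = \bot.
Proof. by move=> e; apply: bundle_bot; rewrite lo_pcomp e setCT. Qed.

Lemma eq_pcompP x y : pcomp x = pcomp y <-> lo x = lo y.
Proof.
split=> e; last by rewrite !pcompE e.
by apply: setC_inj; rewrite -(lo_pcomp x) -(lo_pcomp y) e.
Qed.

End Pseudocomplement.

(** * Sufficiency *)

Lemma preimset_inj (X Y : finType) (p : X -> Y) (q : Y -> X) :
  cancel q p -> injective (fun a : {set Y} => p @^-1: a).
Proof.
move=> qK a b e; apply/setP => y.
by have := congr1 (fun c : {set X} => q y \in c) e; rewrite !inE qK.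
Qed.

Section Quotient.
Variables i j k l : nat.
Hypothesis i_gt0 : (0 < i)%N.
Hypotheses (le_lk : (l <= k)%N) (dvd_lk : (l == 0)%N || (l %| k)%N).
Variables (p : 'I_j -> 'I_i) (q : 'I_i -> 'I_j).
Hypothesis qK : cancel q p.

Let refines (x : bundle j k) (y : bundle i l) : Prop :=
  [/\ lo x = p @^-1: lo y, (mid x * l = mid y * k)%N & hi x = p @^-1: hi y].

Let preim_eq0 (a : {set 'I_i}) : (p @^-1: a == set0) = (a == set0).
Proof. by rewrite -(inj_eq (preimset_inj qK)) preimset0. Qed.

(** For k > 0, c <= c1 forces d <= d1, so meets and joins are taken on the same
    side in both chains; for k = 0 both chains are points. *)
Let proportional_lattice (c c1 : chain k) (d d1 : chain l) :
  (c * l = d * k)%N -> (c1 * l = d1 * k)%N ->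
  ((c `&` c1 : chain k) * l = (d `&` d1 : chain l) * k)%N
  /\ ((c `|` c1 : chain k) * l = (d `|` d1 : chain l) * k)%N.
Proof.
move=> e e1.
wlog le_cc : c c1 d d1 e e1 / c <= c1 => [wl|].
  have /orP[le_cc|le_cc] := le_total c c1; first exact: wl.
  by rewrite meetC joinC [d `&` _]meetC [d `|` _]joinC; apply: wl.
rewrite (meet_l le_cc) (join_r le_cc).
have [//|lt_dd] := leP d d1.
have := ltn_ord d; have := ltn_ord d1; have := ltn_ord c; have := ltn_ord c1.
move: le_cc lt_dd e e1; rewrite leEord ltEord; nia.
Qed.

(** The divisibility assumption makes the relation onto the smaller chain, and
    l <= k makes it functional: for k = 0 every d would be related to 0. *)
Lemma HS_bundle_quotient : HS (bundle j k) (bundle i l).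
Proof.
have j_gt0 : (0 < j)%N.
  by apply: leq_ltn_trans (ltn_ord (q (Ordinal i_gt0))).
apply/HSP; exists refines; split.
- move=> x y x' y' [ea ec eb] [ea' ec' eb']; split; rewrite !coordE.
  + by rewrite ea ea' preimsetI.
  + by have [] := proportional_lattice ec ec'.
  + by rewrite eb eb' preimsetI.
- move=> x y x' y' [ea ec eb] [ea' ec' eb']; split; rewrite !coordE.
  + by rewrite ea ea' preimsetU.
  + by have [] := proportional_lattice ec ec'.
  + by rewrite eb eb' preimsetU.
- move=> x y [ea ec eb]; split; rewrite !coordE ?ea ?eb ?preimsetC //=.
  by have := ltn_ord (mid x); have := ltn_ord (mid y); nia.
- move=> x y [ea ec eb]; rewrite /= !pcompE // ea preim_eq0.
  case: eqP => _; split; rewrite !coordE ?preimsetT ?preimset0 ?preimsetC //=.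
  by rewrite mulnC.
- by split; rewrite !coordE ?preimset0.
- by split; rewrite !coordE ?preimsetT //= mulnC.
- move=> x y y' [ea ec eb] [ea' ec' eb']; apply: bundle_ext.
  + by apply: (preimset_inj qK); rewrite /= -ea -ea'.
  + apply: val_inj => /=; have := ltn_ord (mid y); have := ltn_ord (mid y').
    by nia.
  + by apply: (preimset_inj qK); rewrite /= -eb -eb'.
- move=> y; case: (bundleP y) => -[a ->].
  + by exists (blo k (p @^-1: a)); split; rewrite !coordE ?preimset0.
  + have [c ec] : exists c : chain k, (c * l = a * k)%N.
      case/orP: dvd_lk => [/eqP l0|/dvdnP[r k_rl]].
        have a0 : (a = 0 :> nat)%N by have := ltn_ord a; lia.
        by exists ord0; rewrite a0.
      have le_k : (a * r < k.+1)%N by have := ltn_ord a; nia.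
      by exists (Ordinal le_k); rewrite /= k_rl mulnA.
    by exists (bmid j c); split; rewrite !coordE ?preimsetT ?preimset0.
  + exists (bhi k (p @^-1: a)); split; rewrite !coordE ?preimsetT //=.
    by rewrite mulnC.
Qed.

End Quotient.

Lemma ord_retraction i j : (0 < i <= j)%N ->
  exists (p : 'I_j -> 'I_i) (q : 'I_i -> 'I_j), cancel q p.
Proof.
case/andP => i_gt0 le_ij.
exists (insubd (Ordinal i_gt0)), (widen_ord le_ij) => x.
by apply: val_inj; rewrite val_insubd /= ltn_ord.
Qed.

(** * Necessity *)

Section Necessity.
Variables i j k l : nat.
Hypotheses (i_gt0 : (0 < i)%N) (j_gt0 : (0 < j)%N).
Hypothesis HS_kl : HS (bundle j k) (bundle i l).

(** All sources with a given lo have the same pseudocomplement, whereas the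
    targets blo a, one for each of the 2^i subsets a, have distinct ones. *)
Lemma HS_bundle_rank : (i <= j)%N.
Proof.
have /HSP[R hR] := HS_kl.
rewrite -(leq_exp2l i j (ltnSn 1)).
suff: (#|{set 'I_i}| <= #|{set 'I_j}|)%N.
  by rewrite -!cardsT -!powersetT !card_powerset !cardsT !card_ord.
apply: (leq_card_rel
  (T := fun a b => exists x : bundle j k, R x (blo l a) /\ lo x = b)).
  by move=> a; have [x Rx] := pe_onto hR (blo l a); exists (lo x), x.
move=> a a' b [x [Rx lo_x]] [x' [Rx' lo_x']].
have e : apc x = apc x' by apply/eq_pcompP; rewrite // lo_x.
have := pe_pc hR Rx; rewrite e => /(pe_fun hR)/(_ (pe_pc hR Rx')) pc_aa'.
exact: (iffLR (eq_pcompP i_gt0 (blo l a) (blo l a')) pc_aa').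
Qed.

(** An arbitrary source x of bmid c is corrected to one in the middle chain by a
    term that is the identity on the middle chain of the target. *)
Lemma HS_bundle_center : (l <= k)%N.
Proof.
have /HSP[R hR] := HS_kl.
rewrite -ltnS -[k.+1]card_ord -[l.+1]card_ord.
apply: (leq_card_rel
  (T := fun (c : chain l) (d : chain k) => R (bmid j d) (bmid i c))).
  move=> c; have [x Rx] := pe_onto hR (bmid i c).
  have pc_mid d : pcomp (bmid i d : bundle_lattice i l) = \bot.
    exact: pcomp_lo_setT.
  pose w : bundle j k := ajoin x (apc x).
  have Rw : R w (bmid i c).
    by have := pe_join hR Rx (pe_pc hR Rx); rewrite /= pc_mid joinx0.
  have Rw'c : R (apc (ainv w)) azero.
    by have := pe_pc hR (pe_inv hR Rw); rewrite /= binv_mid pc_mid.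
  pose v : bundle j k := ameet w (ainv (apc (ainv w))).
  have Rv : R v (bmid i c).
    have := pe_meet hR Rw (pe_inv hR Rw'c).
    by rewrite /= binv_bot meetx1.
  (* Otherwise w'* = 1, but w'* is related to 0. *)
  have hi_w'c : hi (apc (ainv w)) = set0.
    rewrite /= pcompE //; case: eqVneq => // lo_w'; exfalso.
    move: Rw'c; rewrite /= pcompE // lo_w' eqxx.
    move=> /(pe_fun hR (pe_one hR))/(congr1 (@lo _ _)); rewrite /= !coordE.
    by apply/eqP/setT_neq0.
  have lo_v : lo v = setT.
    rewrite /v /= !coordE hi_w'c setC0 setIT lo_pcomp //.
    exact: setUCr.
  have hi_v : hi v = set0.
    by rewrite /v /= !coordE lo_pcomp // lo_binv setCK setICr.
  by exists (mid v); rewrite -(bmidE lo_v hi_v).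
move=> c c' d Rc Rc'; have /(congr1 (@mid _ _)) := pe_fun hR Rc Rc'.
by rewrite !coordE.
Qed.

End Necessity.

(** * The two small algebras *)

Lemma HS_bundle_two_chain i k : (0 < i)%N -> HS (bundle i k) two_chain.
Proof.
move=> i_gt0; apply/HSP.
pose f (b : bool) : bundle i k := if b then aone else azero.
exists (fun x b => x = f b).
have inv0 : ainv azero = aone :> bundle i k by exact: binv_bot.
have inv1 : ainv aone = azero :> bundle i k by rewrite -inv0; exact: binvK.
have pc0 : apc azero = aone :> bundle i k.
  by rewrite /= pcompE // lo_bot eqxx.
have pc1 : apc aone = azero :> bundle i k.
  by apply: pcomp_lo_setT; rewrite ?lo_top.
split=> //.
- by move=> _ [] _ [] -> -> /=; rewrite ?meetxx ?meet1x ?meetx1 ?meet0x ?meetx0.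
- by move=> _ [] _ [] -> -> /=; rewrite ?joinxx ?join1x ?joinx1 ?join0x ?joinx0.
- by move=> _ [] ->.
- by move=> _ [] ->.
- move=> _ b b' -> /(congr1 (@lo _ _)).
  case: b b' => -[] //=; rewrite !coordE => e.
    by have := setT_neq0 i_gt0; rewrite e eqxx.
  by have := setT_neq0 i_gt0; rewrite e eqxx.
- by move=> b; exists (f b).
Qed.

(** At an element of the middle chain, ' stays in the middle while * is 0. *)
Lemma not_HS_two_chain_bundle i k : (0 < i)%N -> ~ HS two_chain (bundle i k).
Proof.
move=> i_gt0 /HS_inv_pc/(_ (fun _ => erefl) (bmid i ord0))/(congr1 (@lo _ _)).
rewrite /= lo_pcomp // !coordE setC0 setCT => e.
by have := setT_neq0 i_gt0; rewrite e eqxx.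
Qed.

Lemma not_HS_trivial_two_chain : ~ HS trivial_algebra two_chain.
Proof. by move=> /HS_zero_one/(_ erefl). Qed.

Lemma not_HS_trivial_bundle i k :
  (0 < i)%N -> ~ HS trivial_algebra (bundle i k).
Proof.
move=> i_gt0 /HS_zero_one/(_ erefl)/(congr1 (@lo _ _)).
rewrite lo_bot lo_top => e.
by have := setT_neq0 i_gt0; rewrite e eqxx.
Qed.

Lemma in_IP i m : in_I i m ->
  [\/ i = 0 /\ m = 0, i = 1 /\ m = 0 | (0 < i)%N /\ (0 < m <= 3)%N].
Proof.
case/orP.
  by rewrite !inE => /orP[] /eqP[-> ->]; [constructor 1|constructor 2].
by rewrite !inE => /andP[i_gt0 /or3P[] /eqP ->]; constructor 3.
Qed.

Theorem proposition5p2 (i m j n : nat) (him : in_I i m) (hjn : in_I j n) :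
  HS (BB j n) (BB i m) <-> (i <= j)%N /\ (m <= n)%N.
Proof.
case: (in_IP him) => [[-> ->]|[-> ->]|[i_gt0 m_bd]].
- by split=> // _; exact: HS_trivial.
- case: (in_IP hjn) => [[-> ->]|[-> ->]|[j_gt0 n_bd]].
  + by split=> [/not_HS_trivial_two_chain|[]].
  + by split=> // _; exact: HS_refl.
  + split=> // _; case: n n_bd {hjn} => // k _; exact: HS_bundle_two_chain.
case: m m_bd {him} => // l l_bd.
case: (in_IP hjn) => [[-> ->]|[-> ->]|[j_gt0 n_bd]].
- by split=> [/(not_HS_trivial_bundle i_gt0)|[]].
- by split=> [/(not_HS_two_chain_bundle i_gt0)|[]].
case: n n_bd {hjn} => // k k_bd.
split=> [hs|[le_ij le_lk]].
  by split; [exact: HS_bundle_rank hs|rewrite ltnS; exact: HS_bundle_center hs].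
have [|p [q qK]] := @ord_retraction i j; first by rewrite i_gt0.
(* Below 3, every positive l <= k divides k. *)
apply: (HS_bundle_quotient i_gt0 _ _ qK); first exact: le_lk.
by move: l k l_bd k_bd le_lk => [|[|[|l]]] [|[|[|k]]].
Qed.
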